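(* Let $f=(f_1,\dots,f_m):\mathbb{R}^n\to\mathbb{R}^m$ and $g=(g_1,\dots,g_p):\mathbb{R}^n\to\mathbb{R}^p$ have $C^{1,1}$ components, and let $X=\{x\in\mathbb{R}^n : g_i(x)\le 0,\ i=1,\dots,p\}$. Let $\bar x\in X$ be a local weak efficient solution to the problem of minimizing $f$ over $X$ (with respect to $\mathbb{R}^m_+$). Suppose that the Abadie second-order constraint qualification holds at $\bar x$ with respect to every critical direction, i.e. $L^2(X;\bar x,u)\subset T^2(X;\bar x,u)$ for all $u\in\mathcal{C}(\bar x)$. Let $\bar u\in\mathcal{C}(\bar x)$ be a critical direction at $\bar x$. Then there exist $\lambda\in\mathbb{R}^m_+\setminus\{0\}$ and $\mu\in\mathbb{R}^p_+$ such that \begin{align*} &\sum_{l=1}^m\lambda_l\nabla f_l(\bar x)+\sum_{i=1}^p\mu_i\nabla g_i(\bar x)=0,\\ &\sum_{l=1}^m\lambda_l\langle\xi^{*l},\bar u\rangle+\sum_{i=1}^p\mu_i\langle\zeta^{*i},\bar u\rangle\ge 0,\\ &\lambda_l=0\ \text{ for all } l\notin L(\bar x;\bar u),\\ &\mu_i=0\ \text{ for all } i\notin I(\bar x;\bar u),\\ &\sum_{l=1}^m\lambda_l\langle\nabla f_l(\bar x),w\rangle\ge 0\quad\text{for all } w\in\mathcal{C}(\bar x,\bar u)\cap(\bar u)^{\bot}, \end{align*} where $\xi^{*l}$ and $\zeta^{*i}$ are taken with respect to the direction $\bar u$, and $(\bar u)^{\bot}=\{u\in\mathbb{R}^n : \langle\bar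 u,u\rangle=0\}$.
   Context: A real-valued function on $\mathbb{R}^n$ is $C^{1,1}$ if it is Fréchet differentiable with locally Lipschitz gradient. For $a,b\in\mathbb{R}^m$, $a<b$ means $a_l<b_l$ for all $l$. A point $\bar x\in X$ is a local weak efficient solution if there is a neighborhood $U$ of $\bar x$ such that no $x\in U\cap X$ satisfies $f(x)<f(\bar x)$. Normal cones: for nonempty $\Omega\subset\mathbb{R}^N$ and $z\in\Omega$, $\widehat N(z,\Omega)=\{v : \limsup_{z'\to z,\ z'\in\Omega}\langle v,z'-z\rangle/\|z'-z\|\le 0\}$, and $N(z,\Omega)$ (the limiting/Mordukhovich normal cone) is the set of all $v$ for which there are $z_k\in\Omega$, $z_k\to z$, and $v_k\to v$ with $v_k\in\widehat N(z_k,\Omega)$ for all $k$. Limiting second-order subdifferential: for $\varphi\in C^{1,1}(\mathbb{R}^n)$ and $x,u\in\mathbb{R}^n$, $\partial^2\varphi(x)(u)=\{v\in\mathbb{R}^n : (v,-u)\in N((x,\nabla\varphi(x)),\mathrm{gph}\,\nabla\varphi)\}$; this equals the limiting subdifferential at $x$ of the locally Lipschitz scalar function $\langle u,\nabla\varphi(\cdot)\rangle$, where the limiting subdifferential of $\psi$ at $x$ is $\partial\psi(x)=\{x^* : (x^*,-1)\in N((x,\psi(x)),\mathrm{epi}\,\psi)\}$. The set $\partial^2\varphi(x)(u)$ is nonempty and compact. For a direction $u\in\mathbb{R}^n$, let $\xi^{*l}\in\partial^2f_l(\bar x)(u)$ and $\zeta^{*i}\in\partial^2g_i(\bar x)(u)$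 be elements with $\langle\xi^{*l},u\rangle=\max\{\langle\xi,u\rangle : \xi\in\partial^2f_l(\bar x)(u)\}$ and $\langle\zeta^{*i},u\rangle=\max\{\langle\zeta,u\rangle : \zeta\in\partial^2g_i(\bar x)(u)\}$. Second-order tangent set: $$T^2(X;\bar x,u)=\{v\in\mathbb{R}^n : \exists t_k\downarrow 0,\ \exists v^k\to v,\ \bar x+t_ku+\tfrac12t_k^2v^k\in X\ \ \forall k\in\mathbb{N}\}.$$ Lexicographic order on $\mathbb{R}^2$: $(a_1,a_2)\leqq_{\rm lex}(b_1,b_2)$ iff $a_1<b_1$, or $a_1=b_1$ and $a_2\le b_2$. With $I(\bar x)=\{i : g_i(\bar x)=0\}$, $$L^{2}(X;\bar x,u)=\{v\in\mathbb{R}^n : \big(\langle\nabla g_i(\bar x),u\rangle,\ \langle\nabla g_i(\bar x),v\rangle+\langle\zeta^{*i},u\rangle\big)\leqq_{\rm lex}(0,0)\ \ \forall i\in I(\bar x)\}.$$ Critical directions: $\mathcal{C}(\bar x)$ is the set of all $u\in\mathbb{R}^n$ with $\langle\nabla f_l(\bar x),u\rangle\le 0$ for all $l\in\{1,\dots,m\}$, $\langle\nabla f_l(\bar x),u\rangle=0$ for at least one $l$, and $\langle\nabla g_i(\bar x),u\rangle\le 0$ for all $i\in I(\bar x)$. For $u\in\mathcal{C}(\bar x)$: $L(\bar x;u)=\{l\in\{1,\dots,m\} : \langle\nabla f_l(\bar x),u\rangle=0\}$, $I(\bar x;u)=\{i\in I(\bar x) : \langle\nabla g_i(\bar x),u\rangle=0\}$,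 and $\mathcal{C}(\bar x,u)=\{w\in\mathbb{R}^n : \langle\nabla g_i(\bar x),w\rangle\le 0\ \ \forall i\in I(\bar x;u)\}$. *)

(* Defs.v *)
From HB Require Import structures.
From mathcomp Require Export all_boot all_order all_algebra.
From mathcomp Require Export all_classical all_reals all_analysis.

Set Implicit Arguments.
Unset Strict Implicit.
Unset Printing Implicit Defensive.

Export Order.TTheory GRing.Theory Num.Theory.
Export numFieldNormedType.Exports.

Global Open Scope classical_set_scope.
Global Open Scope ring_scope.

Section SecondOrder.
Context {R : realType}.

(* The library norm on row vectors is the sup norm. It is used only where the
   choice of a norm is immaterial (topology, differentiability, local Lipschitz
   continuity); the Euclidean structure is the following. *)
Definition dot {n} (u v : 'rV[R]_n) : R := \sum_(i < n) u 0 i * v 0 i.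
Definition enorm {n} (u : 'rV[R]_n) : R := Num.sqrt (dot u u).

Definition component {n m} (F : 'rV[R]_n -> 'rV[R]_m) (l : 'I_m)
  : 'rV[R]_n -> R := fun x => F x 0 l.

Definition gradient {n} (phi : 'rV[R]_n -> R) (x : 'rV[R]_n) : 'rV[R]_n :=
  \row_(i < n) 'd phi x (delta_mx 0 i).

Definition locally_lipschitz {n m} (F : 'rV[R]_n -> 'rV[R]_m) : Prop :=
  forall x : 'rV[R]_n, exists2 U : set 'rV[R]_n, nbhs x U & [lipschitz F y | y in U].

Definition C11 {n} (phi : 'rV[R]_n -> R) : Prop :=
  (forall x, differentiable phi x) /\ locally_lipschitz (gradient phi).

Definition vlt {m} (a b : 'rV[R]_m) : Prop := forall l, a 0 l < b 0 l.

Definition local_weak_efficient {n m} (f : 'rV[R]_n -> 'rV[R]_m)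
    (X : set 'rV[R]_n) (xbar : 'rV[R]_n) : Prop :=
  X xbar /\
  exists2 U, nbhs xbar U & ~ exists2 x, (U `&` X) x & vlt (f x) (f xbar).

Definition feasible {n p} (g : 'rV[R]_n -> 'rV[R]_p) : set 'rV[R]_n :=
  [set x | forall i, component g i x <= 0].

(* limsup as z' -> z with z' in Omega and z' <> z; at an isolated point of
   Omega the limsup is -oo and every vector is normal. *)
Definition frechet_normal {N} (z : 'rV[R]_N) (Omega : set 'rV[R]_N)
  : set 'rV[R]_N :=
  [set v | (limf_esup (fun z' : 'rV[R]_N => (dot v (z' - z) / enorm (z' - z))%:E)
              (within Omega z^') <= 0%:E)%E].

Definition limiting_normal {N} (z : 'rV[R]_N) (Omega : set 'rV[R]_N)
  : set 'rV[R]_N :=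
  [set v | exists zk vk : nat -> 'rV[R]_N,
     [/\ forall k, Omega (zk k), zk @ \oo --> z, vk @ \oo --> v
       & forall k, frechet_normal (zk k) Omega (vk k)]].

(* R^n x R^n is encoded as R^(n + n), (x, y) being row_mx x y. *)
Definition graph {n} (F : 'rV[R]_n -> 'rV[R]_n) : set 'rV[R]_(n + n) :=
  [set row_mx x (F x) | x in setT].

Definition subdiff2 {n} (phi : 'rV[R]_n -> R) (x u : 'rV[R]_n)
  : set 'rV[R]_n :=
  [set v | limiting_normal (row_mx x (gradient phi x)) (graph (gradient phi))
             (row_mx v (- u))].

Definition is_maximizer {n} (A : set 'rV[R]_n) (u xi : 'rV[R]_n) : Prop :=
  A xi /\ forall xi', A xi' -> dot xi' u <= dot xi u.

Definition lex_le (a b : R * R) : Prop :=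
  a.1 < b.1 \/ (a.1 = b.1 /\ a.2 <= b.2).

Definition T2 {n} (X : set 'rV[R]_n) (xbar u : 'rV[R]_n) : set 'rV[R]_n :=
  [set v | exists (t : nat -> R) (vk : nat -> 'rV[R]_n),
     [/\ forall k, 0 < t k, t @ \oo --> 0, vk @ \oo --> v
       & forall k, X (xbar + t k *: u + (t k ^+ 2 / 2) *: vk k)]].

Definition active {n p} (g : 'rV[R]_n -> 'rV[R]_p) (xbar : 'rV[R]_n)
  : set 'I_p := [set i | component g i xbar = 0].

(* [zeta] lists the chosen elements zeta^{*i} for the direction [u]. *)
Definition L2 {n p} (g : 'rV[R]_n -> 'rV[R]_p) (xbar u : 'rV[R]_n)
    (zeta : 'I_p -> 'rV[R]_n) : set 'rV[R]_n :=
  [set v | forall i, active g xbar i ->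
     lex_le (dot (gradient (component g i) xbar) u,
             dot (gradient (component g i) xbar) v + dot (zeta i) u)
            (0, 0)].

Definition critical {n m p} (f : 'rV[R]_n -> 'rV[R]_m)
    (g : 'rV[R]_n -> 'rV[R]_p) (xbar : 'rV[R]_n) : set 'rV[R]_n :=
  [set u | [/\ forall l, dot (gradient (component f l) xbar) u <= 0,
               exists l, dot (gradient (component f l) xbar) u = 0
             & forall i, active g xbar i ->
                 dot (gradient (component g i) xbar) u <= 0]].

Definition critical_objectives {n m} (f : 'rV[R]_n -> 'rV[R]_m)
    (xbar u : 'rV[R]_n) : set 'I_m :=
  [set l | dot (gradient (component f l) xbar) u = 0].

Definition critical_constraints {n p} (g : 'rV[R]_n -> 'rV[R]_p)
    (xbar u : 'rV[R]_n) : set 'I_p :=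
  [set i | active g xbar i /\ dot (gradient (component g i) xbar) u = 0].

Definition critical_cone {n p} (g : 'rV[R]_n -> 'rV[R]_p)
    (xbar u : 'rV[R]_n) : set 'rV[R]_n :=
  [set w | forall i, critical_constraints g xbar u i ->
     dot (gradient (component g i) xbar) w <= 0].

Definition orthogonal_space {n} (u : 'rV[R]_n) : set 'rV[R]_n :=
  [set w | dot u w = 0].

End SecondOrder.

(* Main.v *)
Require Import Defs.
From mathcomp Require Import ring lra.

(** A direction [v] satisfying the linearized second-order constraints at a
critical direction [u] is realized, by the constraint qualification, by feasible
parabolas [xbar + t u + t^2/2 v_k]; along them the second-order term of [f_l] is
at most [<grad f_l, v> + <xi_l, u>], so by weak efficiency these quantities
cannot all be negative, and a theorem of the alternative yields multipliers.
Two points need an argument.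

The upper bound on the second-order term amounts to: the upper Dini derivative
along [u] of [psi = <u, grad phi>] is at most [max <xi, u>] over the
second-order subdifferential.  If it exceeds [M], minimizing
[psi (xbar + r u + y) - M r + K |y|^2] produces, arbitrarily close to [xbar],
proximal subgradients of [psi] with slope at least [M] along [u]; they are
normals to the graph of [grad phi], and a limit of them contradicts maximality.

The multipliers of the objectives could all vanish when the second-order system
of the constraints alone is infeasible.  Then [sum mu_i grad g_i = 0] and
[sum mu_i <zeta_i, u> > 0]; adding a large multiple of this [mu] to multipliers
obtained at the critical direction [0], where second-order terms vanish,
restores the second-order inequality. *)

(** * Euclidean inner product and its comparison with the sup norm *)

Section Dot.
Context {R : realType} {n : nat}.
Implicit Types (u v w : 'rV[R]_n) (c : R).

Lemma dotC u v : dot u v = dot v u.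
Proof. by apply: eq_bigr => i _; rewrite mulrC. Qed.

Lemma dotDl u v w : dot (u + v) w = dot u w + dot v w.
Proof. by rewrite -big_split; apply: eq_bigr => i _; rewrite mxE mulrDl. Qed.

Lemma dotZl c u v : dot (c *: u) v = c * dot u v.
Proof. by rewrite /dot mulr_sumr; apply: eq_bigr => i _; rewrite mxE mulrA. Qed.

Lemma dotDr u v w : dot u (v + w) = dot u v + dot u w.
Proof. by rewrite dotC dotDl !(dotC u). Qed.

Lemma dotZr c u v : dot u (c *: v) = c * dot u v.
Proof. by rewrite dotC dotZl dotC. Qed.

Lemma dotNl u v : dot (- u) v = - dot u v.
Proof. by rewrite -scaleN1r dotZl mulN1r. Qed.

Lemma dotNr u v : dot u (- v) = - dot u v.
Proof. by rewrite dotC dotNl dotC. Qed.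

Lemma dot0l v : dot 0 v = 0.
Proof. by rewrite -(scale0r 0) dotZl mul0r. Qed.

Lemma dot0r v : dot v 0 = 0.
Proof. by rewrite dotC dot0l. Qed.

Lemma dot_sqrD u v : dot (u + v) (u + v) = dot u u + 2 * dot u v + dot v v.
Proof. by rewrite dotDl !dotDr (dotC v u); ring. Qed.

Lemma dot_suml (I : finType) (P : pred I) (F : I -> 'rV[R]_n) v :
  dot (\sum_(i | P i) F i) v = \sum_(i | P i) dot (F i) v.
Proof.
by apply: (big_morph (fun u => dot u v)) => [x y|]; rewrite ?dotDl ?dot0l.
Qed.

Lemma dot_ge0 u : 0 <= dot u u.
Proof. by apply: sumr_ge0 => i _; rewrite -expr2 sqr_ge0. Qed.

Lemma coord_le_norm u i : `|u 0 i| <= `|u|.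
Proof.
rewrite [leRHS]/Num.norm /= mx_normrE; apply/bigmax_geP.
by right; exists (0, i).
Qed.

Lemma norm_le_coord u (e : R) :
  0 <= e -> (forall i, `|u 0 i| <= e) -> `|u| <= e.
Proof.
move=> e0 ue; rewrite [leLHS]/Num.norm /= mx_normrE.
by apply/bigmax_leP; split=> // -[k i] _ /=; rewrite ord1.
Qed.

Lemma normr_dot_le u v : `|dot u v| <= n%:R * (`|u| * `|v|).
Proof.
apply: (le_trans (ler_norm_sum _ _ _)).
rewrite -[n in n%:R]card_ord -sum1_card natr_sum mulr_suml.
apply: ler_sum => i _; rewrite mul1r normrM.
by apply: ler_pM => //; exact: coord_le_norm.
Qed.

Lemma sqr_norm_le_dot u : `|u| ^+ 2 <= dot u u.
Proof.
rewrite -[dot u u]sqr_sqrtr ?dot_ge0 // ler_pXn2r ?nnegrE ?sqrtr_ge0 //.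
apply: norm_le_coord => [|i]; first exact: sqrtr_ge0.
rewrite -sqrtr_sqr ler_sqrt ?dot_ge0 // expr2 /dot (bigD1 i) //= lerDl.
by apply: sumr_ge0 => l _; rewrite -expr2 sqr_ge0.
Qed.

Lemma dot_delta u i : dot u (delta_mx 0 i) = u 0 i.
Proof.
rewrite /dot (bigD1 i) //= mxE !eqxx mulr1 big1 ?addr0 // => j /negbTE ji.
by rewrite mxE eqxx ji mulr0.
Qed.
End Dot.

Lemma dot_row_mx (R : realType) n1 n2 (u1 v1 : 'rV[R]_n1) (u2 v2 : 'rV[R]_n2) :
  dot (row_mx u1 u2) (row_mx v1 v2) = dot u1 v1 + dot u2 v2.
Proof.
rewrite /dot big_split_ord /=.
by congr (_ + _); apply: eq_bigr => i _; rewrite ?row_mxEl ?row_mxEr.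
Qed.

(** * Gradients, restriction to lines, and local Lipschitz bounds *)

Section Calculus.
Context {R : realType} {n : nat}.
Implicit Types (x h u v w : 'rV[R]_n).

Lemma diff_gradient (phi : 'rV[R]_n -> R) x h :
  differentiable phi x -> 'd phi x h = dot (gradient phi x) h.
Proof.
move=> phix; rewrite [h in LHS]row_sum_delta linear_sum.
by apply: eq_bigr => i _; rewrite linearZ mxE /= mulrC.
Qed.

Lemma is_derive_line (phi : 'rV[R]_n -> R) x h (t : R) :
  differentiable phi (x + t *: h) ->
  is_derive t 1 (fun s : R => phi (x + s *: h))
    (dot (gradient phi (x + t *: h)) h).
Proof.
move=> phix.
have dl : is_diff t (fun s : R => x + s *: h) ( *:%R^~ h).
  have -> : (fun s : R => x + s *: h) = cst x + ( *:%R^~ h) by apply/funext.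
  have := is_diffD (is_diff_cst x t) (is_diff_scalel t h).
  by rewrite add0r.
have dphi : differentiable (phi \o (fun s : R => x + s *: h)) t.
  by apply: differentiable_comp => //; exact: ex_diff.
apply: DeriveDef; first exact: diff_derivable.
by rewrite deriveE // diff_comp // diff_val /= scale1r diff_gradient.
Qed.

Lemma mvt_line (phi : 'rV[R]_n -> R) x h : (forall y, differentiable phi y) ->
  exists2 s : R, 0 < s < 1 &
    phi (x + h) - phi x = dot (gradient phi (x + s *: h)) h.
Proof.
move=> dphi.
have d (t : R) : is_derive t 1 (fun s : R => phi (x + s *: h))
    (dot (gradient phi (x + t *: h)) h) by exact: is_derive_line.
have [|s s01] := MVT (@ltr01 R) (fun t _ => d t).
  apply: continuous_subspaceT => t; apply: differentiable_continuous.
  exact/derivable1_diffP/ex_derive.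
by rewrite scale1r scale0r addr0 subr0 mulr1; exists s => //; rewrite -in_itv.
Qed.

Lemma cvg_dot {T : Type} {F : set_system T} {FF : Filter F}
    {f g : T -> 'rV[R]_n} {u v} :
  f @ F --> u -> g @ F --> v -> (fun t => dot (f t) (g t)) @ F --> dot u v.
Proof.
move=> fu gv; rewrite /dot.
apply: (@cvg_big _ _ +%R 0) => [|i _]; first exact: add_continuous.
have coord (k : T -> 'rV[R]_n) w : k @ F --> w -> k t 0 i @[t --> F] --> w 0 i.
  move=> kw; apply: (cvg_comp k (fun M : 'rV[R]_n => M 0 i) kw).
  exact: coord_continuous.
by apply: cvgM; exact: coord.
Qed.

Lemma cvg_enorm {T : Type} {F : set_system T} {FF : Filter F}
    {f : T -> 'rV[R]_n} {u} :
  f @ F --> u -> enorm (f t) @[t --> F] --> enorm u.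
Proof.
move=> fu; apply: (cvg_comp (fun t => dot (f t) (f t)) Num.sqrt).
  exact: (cvg_dot fu fu).
exact: sqrt_continuous.
Qed.

Lemma locally_lipschitzP {m} (F : 'rV[R]_n -> 'rV[R]_m) x :
  locally_lipschitz F -> exists delta L : R, [/\ 0 < delta, 0 < L &
    forall y z, ball x delta y -> ball x delta z ->
      `|F y - F z| <= L * `|y - z|].
Proof.
move=> /(_ x)[U /nbhs_ballP[d /= d0 dU] [M [_ lipU]]].
(* Every constant beyond [M] is a Lipschitz constant; the maximum with 1 makes it positive. *)
exists d, (Num.max (M + 1) 1); split=> //; first by rewrite lt_max ltr01 orbT.
move=> y z /dU Uy /dU Uz; apply: (lipU _ _ (y, z)) => //.
by rewrite lt_max ltrDl ltr01.
Qed.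

Lemma locally_lipschitz_continuous {m} (F : 'rV[R]_n -> 'rV[R]_m) :
  locally_lipschitz F -> continuous F.
Proof.
move=> lip x; have [d [L [d0 L0 lipd]]] := locally_lipschitzP F x lip.
apply/(@cvgrPdist_le _ _ _ _ (nbhs_filter x)) => e e0; near=> y.
apply: (le_trans (lipd _ _ (ballxx _ d0) _)).
  by near: y; exact: nbhsx_ballx.
have : ball x (e / L) y by near: y; apply: nbhsx_ballx; rewrite divr_gt0.
by rewrite -ball_normE /= ltr_pdivlMr // mulrC => /ltW.
Unshelve. all: by end_near. Qed.

End Calculus.

(** * Proximal subgradients and an approximate mean value inequality *)

Section Subgradient.
Context {R : realType} {n : nat}.
Implicit Types (x y z u v : 'rV[R]_n).

Definition proximal_subgradient (psi : 'rV[R]_n -> R) y v : Prop :=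
  exists K : R, \forall z \near y,
    psi y + dot v (z - y) - K * dot (z - y) (z - y) <= psi z.

Lemma compact_norm_le (r : R) : compact [set y : 'rV[R]_n | `|y| <= r].
Proof.
apply: bounded_closed_compact.
  exists r; split; first exact: num_real.
  by move=> M rM y /= yr; apply: le_trans (ltW rM).
apply: (@closed_comp _ _ (fun y : 'rV[R]_n => `|y|) [set a | a <= r]).
  by move=> y _; exact: norm_continuous.
exact: closed_le.
Qed.

(* Minimizing [psi (x + r u + y) - M r + K |y|^2] for a large penalty [K] gives
   an interior minimizer: stationarity in [y] makes [- 2 K y] a proximal
   subgradient, stationarity in [r] bounds its slope along [u] from below. *)
Lemma approximate_mean_value (psi : 'rV[R]_n -> R) x u (delta L s M : R) :
  continuous psi -> 0 < delta -> 0 < L -> 0 < s -> s * `|u| < delta / 2 ->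
  (forall y z, ball x delta y -> ball x delta z ->
     `|psi y - psi z| <= L * `|y - z|) ->
  M * s < psi (x + s *: u) - psi x ->
  exists y v, [/\ ball x delta y, `|v| <= 2 * L, M <= dot v u &
    proximal_subgradient psi y v].
Proof.
move=> psi_cont d0 L0 s0 su lip slope.
pose e := psi (x + s *: u) - psi x - M * s.
have e0 : 0 < e by rewrite subr_gt0.
(* The term [2 * L / delta] gives [KL], which keeps the minimizer inside the ball; the term
   [L ^+ 2 / e] gives [KLe], which excludes [r = s]. *)
pose K := L ^+ 2 / e + 2 * L / delta + 1.
have K0 : 0 < K by rewrite !addr_gt0 ?divr_gt0 ?exprn_gt0 ?mulr_gt0.
have KL : L / K < delta / 2.
  rewrite ltr_pdivrMr // -ltr_pdivrMl ?divr_gt0 //.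
  have -> : (delta / 2)^-1 * L = 2 * L / delta by field; rewrite gt_eqF.
  have : 0 < L ^+ 2 / e by rewrite divr_gt0 ?exprn_gt0.
  rewrite /K; lra.
have KLe : L * (L / K) < e.
  rewrite mulrA ltr_pdivrMr // [e * K]mulrC -ltr_pdivrMr // -expr2 /K.
  have : 0 < 2 * L / delta by rewrite divr_gt0 ?mulr_gt0.
  lra.
pose A := [set y : 'rV[R]_n | `|y| <= delta / 2] `*` `[0, s]%classic.
pose point (q : 'rV[R]_n * R) := x + q.2 *: u + q.1.
pose Phi (q : 'rV[R]_n * R) := psi (point q) - M * q.2 + K * dot q.1 q.1.
have d2 : 0 <= delta / 2 by rewrite ltW // divr_gt0.
have s_ge0 := ltW s0.
have inA y r : `|y| <= delta / 2 -> 0 <= r <= s -> A (y, r).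
  by move=> yd rs; split=> //=; rewrite in_itv.
have pointA q : A q -> ball x delta (point q).
  move=> [/= yd]; rewrite in_itv /= => /andP[r0 rs]; rewrite -ball_normE /=.
  rewrite /point -addrA opprD addNKr normrN (le_lt_trans (ler_normD _ _)) //.
  rewrite normrZ ger0_norm // (le_lt_trans (y := s * `|u| + delta / 2)) //;
    last lra.
  by apply: lerD => //; exact: ler_wpM2r.
have Phi_cont : continuous Phi.
  move=> q; have fq : fst x0 @[x0 --> q] --> q.1 by exact: cvg_fst.
  have sq : snd x0 @[x0 --> q] --> q.2 by exact: cvg_snd.
  apply: cvgD; last by apply: cvgMl_tmp; exact: cvg_dot.
  apply: cvgB; last exact: cvgMl_tmp.
  apply: (cvg_comp point psi); last exact: psi_cont.
  by apply: cvgD => //; apply: cvgD; [exact: cvg_cst | exact: cvgZr_tmp].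
have [|||[y r] + min] := @compact_EVT_min _ _ Phi A.
- by exists (0, 0); apply: inA; rewrite ?normr0 // lexx s_ge0.
- by apply: compact_setX; [exact: compact_norm_le | exact: segment_compact].
- exact: continuous_subspaceT.
have {}min q : A q -> Phi (y, r) <= Phi q by move=> Aq; apply: min; rewrite inE.
rewrite inE => Ayr; have [/= yd] := Ayr; rewrite in_itv /= => /andP[r0 rs].
(* Comparison with [(0, r)]: the penalty cannot exceed what [psi] gains by the Lipschitz bound. *)
have y_dot : K * dot y y <= L * `|y|.
  have A0r : A (0, r) by apply: inA; rewrite ?normr0 // r0 rs.
  have := min _ A0r; rewrite /Phi /= dot0l mulr0 addr0.
  have := lip _ _ (pointA _ A0r) (pointA _ Ayr).
  rewrite /point /= addr0 opprD addNKr normrN ler_norml => /andP[_]; lra.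
have y_norm : `|y| <= L / K.
  have [->|y0] := eqVneq y 0; first by rewrite normr0 ltW ?divr_gt0.
  rewrite ler_pdivlMr // -(ler_pM2r (x := `|y|)) ?normr_gt0 //.
  apply: le_trans y_dot; have -> : `|y| * K * `|y| = K * `|y| ^+ 2 by ring.
  by rewrite ler_pM2l // sqr_norm_le_dot.
have yd' := le_lt_trans y_norm KL.
(* At [r = s], comparison with [(0, 0)] would give [e <= L * |y| <= L * (L / K)], against [KLe]. *)
have {rs} rs : r < s.
  rewrite lt_neqAle rs andbT; apply/eqP => rs'.
  have A00 : A (0, 0) by apply: inA; rewrite ?normr0 // lexx s_ge0.
  have A0s : A (0, s).
    by apply: inA; rewrite ?normr0 // lexx s_ge0.
  have := min _ A00; have := lip _ _ (pointA _ A0s) (pointA _ Ayr).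
  rewrite /Phi /point rs' /= dot0l !addr0 scale0r addr0 !mulr0 subr0 addr0.
  rewrite opprD addNKr normrN ler_norml => /andP[_].
  have : 0 <= K * dot y y.
    by rewrite mulr_ge0 ?dot_ge0 // ltW.
  have : L * `|y| <= L * (L / K) by rewrite ler_pM2l.
  by move: KLe; rewrite /e; lra.
exists (point (y, r)), ((- 2 * K) *: y); split.
- exact: pointA.
- rewrite normrZ normrM normrN !gtr0_norm // -mulrA ler_pM2l //.
  by rewrite mulrC -ler_pdivlMr.
(* Moving to [(y - t u, r + t)], possible since [r < s], leaves [point] fixed, so [psi] cancels; if
   the slope were below [M], the linear gain would beat the penalty term of order [t^2]. *)
- rewrite leNgt; apply/negP; rewrite dotZl => lt_M.
  have Ku : 0 < K * dot u u + 1.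
    by rewrite ltr_wpDl // mulr_ge0 ?dot_ge0 // ltW.
  near (0 : R)^'+ => t.
  have t0 : 0 < t by [].
  have yt : `|y - t *: u| <= delta / 2.
    rewrite (le_trans (ler_normB _ _)) // normrZ gtr0_norm // -lerBrDl.
    apply: (@le_trans _ _ (t * (`|u| + 1))).
      by rewrite ler_pM2l // lerDl.
    rewrite -ler_pdivlMr ?ltr_wpDl //; near: t; apply: nbhs_right_le.
    by rewrite divr_gt0 ?subr_gt0 // ltr_wpDl.
  have rt : 0 <= r + t <= s.
    apply/andP; split; first by rewrite addr_ge0 // ltW.
    rewrite -lerBrDl; near: t; apply: nbhs_right_le.
    by rewrite subr_gt0.
  have small : t * (K * dot u u + 1) <= M - - 2 * K * dot y u.
    rewrite -ler_pdivlMr //; near: t; apply: nbhs_right_le.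
    by rewrite divr_gt0 // subr_gt0.
  have := min _ (inA _ _ yt rt).
  have -> : Phi (y - t *: u, r + t) = psi (point (y, r)) - M * (r + t) +
      K * (dot y y - 2 * t * dot y u + t ^+ 2 * dot u u).
    rewrite /Phi /=; congr (psi _ - _ + K * _).
      by rewrite /point; apply/rowP => i; rewrite !mxE /=; ring.
    by rewrite dot_sqrD dotNl !dotNr !dotZl !dotZr; ring.
  rewrite /Phi /= => le_t.
  have : t * (M - - 2 * K * dot y u) <= t * (t * (K * dot u u)) by lra.
  by rewrite ler_pM2l //; move: small t0; rewrite mulrDr; lra.
- exists K; near=> z; set h := z - _.
  have Ah : A (y + h, r).
    apply: inA; last by rewrite r0 ltW.
    rewrite (le_trans (ler_normD _ _)) // -lerBrDl /h distrC; apply: ltW.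
    have : ball (point (y, r)) (delta / 2 - `|y|) z.
      by near: z; apply: nbhsx_ballx; rewrite subr_gt0.
    by rewrite -ball_normE.
  have := min _ Ah.
  have -> : Phi (y + h, r) = psi z - M * r +
      K * (dot y y + 2 * dot y h + dot h h).
    rewrite /Phi /=; congr (psi _ - _ + K * _).
      by rewrite /point /= addrA /h addrC subrK.
    exact: dot_sqrD.
  by rewrite /Phi /= dotZl; lra.
Unshelve. all: by end_near. Qed.

End Subgradient.

(** * From proximal subgradients to the second-order subdifferential *)

Section Coderivative.
Context {R : realType} {n : nat}.
Implicit Types (x y z u v : 'rV[R]_n).

(** The proximal inequality bounds the pairing of [(v, - u)] with [(a - y, G a - G y)] by
    [K |a - y|^2], which is at most [|K|] times the squared distance in the graph, hence negligible
    against that distance. *)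
Lemma proximal_subgradient_normal (G : 'rV[R]_n -> 'rV[R]_n) y u v :
  proximal_subgradient (fun x => dot u (G x)) y v ->
  frechet_normal (row_mx y (G y)) (graph G) (row_mx v (- u)).
Proof.
move=> [K prox]; rewrite /frechet_normal /=; set z := row_mx y (G y).
apply/lee_addgt0Pr => e e0; rewrite add0e.
set q := fun w => _.
(* The limsup is an infimum of suprema over members of the filter; the sublevel set of [q] at level
   [e] will be such a member. *)
apply: (@le_trans _ _ (ereal_sup (q @` [set w | (q w <= e%:E)%E]))); last first.
  by apply: ub_ereal_sup => _ [w /= qw <-].
apply: ereal_inf_lbound; exists [set w | (q w <= e%:E)%E] => //.
have lz : lsubmx w @[w --> z] --> y.
  rewrite -[X in _ --> X](row_mxKl y (G y)).
  exact/differentiable_continuous/differentiable_lsubmx.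
have wz : w - z @[w --> z] --> z - z.
  apply: (@cvgB _ _ _ (nbhs z) (nbhs_filter z) id (cst z)) => //.
  exact: cvg_cst.
have := @cvg_enorm _ _ _ _ (nbhs_filter z) _ _ wz.
rewrite subrr {2}/enorm dot0l sqrtr0 => ez.
suff near_z : \forall w \near z, graph G w -> (q w <= e%:E)%E.
  by apply: filterS near_z => w qw _.
have K1 : 0 < `|K| + 1 by rewrite ltr_wpDl.
have small : \forall w \near z, enorm (w - z) <= e / (`|K| + 1).
  by apply: (cvgr_le _ ez); rewrite divr_gt0.
near=> w => -[a _ aw].
have proxa :
    dot u (G y) + dot v (a - y) - K * dot (a - y) (a - y) <= dot u (G a).
  have : dot u (G y) + dot v (lsubmx w - y) -
      K * dot (lsubmx w - y) (lsubmx w - y) <= dot u (G (lsubmx w)).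
    by near: w; exact: (lz _ prox).
  by rewrite -aw row_mxKl.
have ew : enorm (w - z) <= e / (`|K| + 1).
  by near: w; exact: small.
(* [w = z] is still allowed here; the quotient is then 0, the inverse of 0 being 0. *)
rewrite /q lee_fin; have [->|ew0] := eqVneq (enorm (w - z)) 0.
  by rewrite invr0 mulr0 ltW.
have ew_gt0 : 0 < enorm (w - z) by rewrite lt_neqAle eq_sym ew0 sqrtr_ge0.
rewrite ler_pdivrMr //.
have wzE : w - z = row_mx (a - y) (G a - G y).
  by rewrite -aw /z opp_row_mx add_row_mx.
have sqr_ew : enorm (w - z) ^+ 2 =
    dot (a - y) (a - y) + dot (G a - G y) (G a - G y).
  by rewrite /enorm sqr_sqrtr ?dot_ge0 // wzE dot_row_mx.
rewrite [X in dot _ X]wzE dot_row_mx dotNl (dotDr u) dotNr.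
have le1 : K * dot (a - y) (a - y) <= `|K| * enorm (w - z) ^+ 2.
  apply: (le_trans (ler_wpM2r (dot_ge0 _) (ler_norm K))).
  by rewrite ler_wpM2l // sqr_ew lerDl dot_ge0.
have le2 : `|K| * enorm (w - z) ^+ 2 <= e * enorm (w - z).
  rewrite expr2 mulrA ler_pM2r //.
  rewrite ler_pdivlMr // in ew; apply: le_trans ew; rewrite mulrC ler_pM2l //.
  by rewrite lerDl.
lra.
Unshelve. all: by end_near. Qed.

Lemma cvg_row_mx {T : Type} {F : set_system T} {FF : Filter F}
    {f g : T -> 'rV[R]_n} {a b : 'rV[R]_n} :
  f @ F --> a -> g @ F --> b ->
  row_mx (f t) (g t) @[t --> F] --> row_mx a b.
Proof.
move=> fa gb; apply/cvgrPdist_le => e e0; near=> k.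
rewrite opp_row_mx add_row_mx; apply: norm_le_coord => [|i]; first exact: ltW.
case: (split_ordP i) => j ->.
  rewrite row_mxEl; apply: (le_trans (coord_le_norm _ _)).
  by near: k; exact: cvgr_dist_le.
rewrite row_mxEr; apply: (le_trans (coord_le_norm _ _)).
by near: k; exact: cvgr_dist_le.
Unshelve. all: by end_near. Qed.

(** A cluster point is approached within [1 / (k + 1)] by some term of index at least [k]. The bound
    [k <= h k], in place of monotonicity of [h], is enough to carry limits over. *)
Lemma bounded_subsequence (B : R) (vk : nat -> 'rV[R]_n) :
  (forall k, `|vk k| <= B) -> exists v (h : nat -> nat),
    (forall k, (k <= h k)%N) /\ vk (h k) @[k --> \oo] --> v.
Proof.
move=> vB; have [|v [_ v_cl]] := @compact_norm_le R n B (vk @ \oo).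
  by exists 0%N => // k _; exact: vB.
have close k : exists j, (k <= j)%N /\ `|v - vk j| < k.+1%:R^-1.
  have [||w [[j /= kj <-] wv]] :=
      v_cl [set vk j | j in [set j | (k <= j)%N]] (ball v k.+1%:R^-1).
  - by exists k => // j /= kj; exists j.
  - by apply: nbhsx_ballx; rewrite invr_gt0.
  by exists j; split=> //; rewrite -ball_normE in wv.
have [h hP] := choice close.
exists v, h; split=> [k|]; first by have [] := hP k.
apply/cvgrPdist_le => e e0; near=> k.
have [_ /ltW/le_trans] := hP k; apply.
apply: ltW; near: k; exact: near_infty_natSinv_lt (PosNum e0).
Unshelve. all: by end_near. Qed.

(** Subgradients taken at points tending to [x] are bounded, so a subsequence converges; the
    corresponding Fréchet normals to the graph then converge to a limiting normal, and the slope
    bound passes to the limit. *)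
Lemma subdiff2_closed_graph (phi : 'rV[R]_n -> R) x u (B M : R) :
  continuous (gradient phi) ->
  (forall delta, 0 < delta -> exists y v,
     [/\ ball x delta y, `|v| <= B, M <= dot v u &
         proximal_subgradient (fun z => dot u (gradient phi z)) y v]) ->
  exists2 xi, subdiff2 phi x u xi & M <= dot xi u.
Proof.
move=> gcont near_sub.
have /choice[yk /choice[vk ykP]] : forall k, exists y, exists v,
    [/\ ball x k.+1%:R^-1 y, `|v| <= B, M <= dot v u &
        proximal_subgradient (fun z => dot u (gradient phi z)) y v].
  by move=> k; apply: near_sub; rewrite invr_gt0.
have [|v [h [hk hv]]] := bounded_subsequence B vk.
  by move=> k; have [] := ykP k.
exists v; last first.
  apply: (cvgr_to_ge (cvg_dot hv (cvg_cst u))).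
  by near=> k; have [] := ykP (h k).
have yx : yk (h k) @[k --> \oo] --> x.
  apply/cvgrPdist_le => e e0; near=> k.
  have [yb _ _ _] := ykP (h k).
  move: yb; rewrite -ball_normE /= => /ltW/le_trans; apply.
  apply: (@le_trans _ _ k.+1%:R^-1).
    by rewrite lef_pV2 ?posrE // ler_nat ltnS.
  by apply: ltW; near: k; exact: near_infty_natSinv_lt (PosNum e0).
exists (fun k => row_mx (yk (h k)) (gradient phi (yk (h k)))),
  (fun k => row_mx (vk (h k)) (- u)); split.
- by move=> k; exists (yk (h k)).
- apply: cvg_row_mx => //; exact: (cvg_comp _ _ yx (gcont x)).
- by apply: cvg_row_mx => //; exact: cvg_cst.
- by move=> k; apply: proximal_subgradient_normal; have [] := ykP (h k).
Unshelve. all: by end_near. Qed.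

End Coderivative.

(** * Second-order upper bounds along lines and descent along parabolas *)

Lemma derive_upper_slope {R : realType} (k h : R -> R) (t : R) :
  0 < t -> (forall s : R, is_derive s 1 k (h s)) ->
  forall M, (forall s, 0 < s < t -> h s - h 0 <= M * s) ->
  k t <= k 0 + t * h 0 + M * t ^+ 2 / 2.
Proof.
move=> t0 dk M slope.
(* [q] is [k] minus its expected quadratic majorant, up to a constant; [slope] makes its derivative
   nonpositive on [(0, t)]. *)
pose q := k - (h 0 \*: id) - ((M / 2) \*: (id ^+ 2)).
have dq (s : R) : is_derive s 1 q (h s - h 0 - M * s).
  by apply: is_derive_eq; rewrite /GRing.scale /= expr1 !mulr1; lra.
have [|s s_in qt] := MVT t0 (fun s _ => dq s).
  apply: continuous_subspaceT => s; apply: differentiable_continuous.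
  exact/derivable1_diffP/ex_derive.
have s0t : 0 < s < t by rewrite in_itv in s_in.
have : (h s - h 0 - M * s) * (t - 0) <= 0.
  by rewrite subr0 pmulr_lle0 //; have := slope s s0t; lra.
have qE r : q r = k r - h 0 * r - M / 2 * r ^+ 2 by [].
by rewrite -qt !qE mulr0 expr0n /= mulr0; lra.
Qed.

Section SecondOrderExpansion.
Context {R : realType} {n : nat} {phi : 'rV[R]_n -> R} (phi_C11 : C11 phi).
Implicit Types (x u v xi : 'rV[R]_n).

Let dphi : forall y, differentiable phi y := phi_C11.1.
Let gradient_cont : continuous (gradient phi) :=
  locally_lipschitz_continuous _ phi_C11.2.

Lemma gradient_upper_slope x u xi (M : R) :
  is_maximizer (subdiff2 phi x u) u xi -> dot xi u < M ->
  exists2 delta : R, 0 < delta & forall s, 0 < s < delta ->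
    dot u (gradient phi (x + s *: u)) - dot u (gradient phi x) <= M * s.
Proof.
move=> [_ xi_max] xiM; apply: contrapT => no_delta.
have [d [L [d0 L0 lip]]] := locally_lipschitzP _ x phi_C11.2.
(* A positive Lipschitz constant of [<u, grad phi>] for the sup norm; the factor [n] comes from
   [normr_dot_le]. *)
pose L' := n%:R * `|u| * L + 1.
have [eta eta0|xi' /xi_max le_xi] :=
    subdiff2_closed_graph phi x u (2 * L') M gradient_cont; last first.
  by move=> /le_trans/(_ le_xi); rewrite leNgt xiM.
pose e := Num.min d eta.
have e0 : 0 < e by rewrite lt_min d0.
have [s /andP[s0 se] slope] : exists2 s, 0 < s < e / 2 / (`|u| + 1) &
    M * s < dot u (gradient phi (x + s *: u)) - dot u (gradient phi x).
  apply: contrapT => no_s; apply: no_delta.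
  exists (e / 2 / (`|u| + 1)); first by rewrite !divr_gt0 // ltr_wpDl.
  by move=> s s_small; rewrite leNgt; apply/negP => ?; apply: no_s; exists s.
have [|||||z w||y [v [xy vB vM prox]]] :=
    @approximate_mean_value _ _ (fun z => dot u (gradient phi z)) x u e L' s M.
- by move=> z; exact: (cvg_dot (cvg_cst u) (gradient_cont z)).
- by [].
- by rewrite /L' ltr_wpDl // !mulr_ge0 // ltW.
- by [].
- rewrite ltr_pdivlMr ?ltr_wpDl // in se; apply: le_lt_trans se.
  by rewrite ler_pM2l // lerDl.
- have e_d : e <= d by rewrite ge_min lexx.
  move=> /(le_ball e_d) zd /(le_ball e_d) wd.
  rewrite -dotNr -dotDr (le_trans (normr_dot_le _ _)) //.
  apply: (@le_trans _ _ (n%:R * `|u| * (L * `|z - w|))).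
    by rewrite -mulrA; do 2! apply: ler_wpM2l => //; exact: lip.
  by rewrite mulrA ler_wpM2r // lerDl.
- exact: slope.
exists y, v; split=> //; apply: le_ball xy.
by rewrite ge_min lexx orbT.
Qed.

Lemma second_order_upper_bound x u xi (M : R) :
  is_maximizer (subdiff2 phi x u) u xi -> dot xi u < M ->
  exists2 delta : R, 0 < delta & forall t, 0 < t < delta ->
    phi (x + t *: u) <= phi x + t * dot (gradient phi x) u + M * t ^+ 2 / 2.
Proof.
move=> xi_max xiM; have [d d0 slope] := gradient_upper_slope _ _ _ _ xi_max xiM.
exists d => // t /andP[t0 td].
have slope_t s : 0 < s < t ->
    dot u (gradient phi (x + s *: u)) - dot u (gradient phi (x + 0 *: u))
      <= M * s.
  by move=> /andP[s0 st]; rewrite scale0r addr0 slope // s0 (lt_trans st).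
have dk (s : R) : is_derive s 1 (fun s : R => phi (x + s *: u))
    (dot u (gradient phi (x + s *: u))).
  by rewrite dotC; exact: is_derive_line.
have := derive_upper_slope _ (fun s => dot u (gradient phi (x + s *: u))) _
  t0 dk _ slope_t.
by rewrite scale0r addr0 => le_t; rewrite (dotC _ u).
Qed.

(** The intermediate points of the mean value theorem tend to [x], where the gradient is continuous.
    The base points may move, so that the second leg of a parabola is covered. *)
Lemma mvt_cvg x (z w : nat -> 'rV[R]_n) (a : nat -> R) v :
  z @ \oo --> x -> a @ \oo --> 0 -> w @ \oo --> v ->
  exists2 d : nat -> R, d @ \oo --> dot (gradient phi x) v &
    forall k, phi (z k + a k *: w k) - phi (z k) = a k * d k.
Proof.
move=> zx a0 wv.
have /choice[s sP] k : exists s, 0 < s < 1 /\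
    phi (z k + a k *: w k) - phi (z k) =
      dot (gradient phi (z k + s *: (a k *: w k))) (a k *: w k).
  by have [s s01 e] := mvt_line phi (z k) (a k *: w k) dphi; exists s.
have yx : z k + s k *: (a k *: w k) @[k --> \oo] --> x.
  rewrite -[X in _ --> X]addr0; apply: cvgD => //.
  have aw : a k *: w k @[k --> \oo] --> (0 : 'rV[R]_n).
    by rewrite -(scale0r v); exact: cvgZ.
  apply/cvgr0Pnorm_le => e e0; near=> k.
  have [/andP[s0 s1] _] := sP k.
  rewrite normrZ gtr0_norm // (@le_trans _ _ `|a k *: w k|) //.
    by rewrite ler_piMl // ltW.
  by near: k; move/cvgr0Pnorm_le: aw; apply.
exists (fun k => dot (gradient phi (z k + s k *: (a k *: w k))) (w k)).
  exact: (cvg_dot (cvg_comp _ _ yx (gradient_cont x)) wv).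
by move=> k; have [_ ->] := sP k; rewrite dotZr.
Unshelve. all: by end_near. Qed.

(** If the first-order term is negative, the parabola is a step [t k] along a direction tending to
    [u]. Otherwise it splits into a step along [u], controlled to second order by [xi], and a step
    of size [t k ^+ 2 / 2] along [vk k]. *)
Lemma parabolic_descent x u v xi (t : nat -> R) (vk : nat -> 'rV[R]_n) :
  is_maximizer (subdiff2 phi x u) u xi ->
  dot (gradient phi x) u < 0 \/
    dot (gradient phi x) u = 0 /\ dot (gradient phi x) v + dot xi u < 0 ->
  (forall k, 0 < t k) -> t @ \oo --> 0 -> vk @ \oo --> v ->
  \forall k \near \oo, phi (x + t k *: u + (t k ^+ 2 / 2) *: vk k) < phi x.
Proof.
move=> xi_max descent t_gt0 t0 vv.
have t20 : t k ^+ 2 / 2 @[k --> \oo] --> (0 : R).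
  have -> : (0 : R) = 0 * 0 / 2 by rewrite !mul0r.
  by apply: cvgMr_tmp; exact: cvgM.
case: descent => [u_lt0|[u0 strict]].
  have [|d du e] :=
    mvt_cvg x (cst x) (fun k => u + (t k / 2) *: vk k) t u (cvg_cst _) t0.
    rewrite -[X in _ --> X]addr0 -(scale0r v).
    apply: cvgD; first exact: cvg_cst.
    by apply: cvgZ => //; rewrite -(mul0r 2^-1); exact: cvgMr_tmp.
  near=> k.
  have dk : d k < 0 by near: k; exact: (cvgr_lt _ du).
  have := e k; rewrite scalerDr scalerA mulrA -expr2 addrA /= => ek.
  by rewrite -subr_lt0 ek pmulr_rlt0.
(* The midpoint of [<xi, u>] and [- <grad phi x, v>]: it exceeds the first, and [- M] exceeds the
   limit of [d k]. *)
pose M := (dot xi u - dot (gradient phi x) v) / 2.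
have [|delta delta0 bound] := second_order_upper_bound _ _ _ M xi_max.
  by rewrite /M; lra.
have [|d dv e] := mvt_cvg x (fun k => x + t k *: u) vk _ v _ t20 vv.
  rewrite -[X in _ --> X]addr0 -(scale0r u).
  by apply: cvgD; [exact: cvg_cst | exact: cvgZr_tmp].
near=> k.
have dk : d k < - M.
  by near: k; apply: (cvgr_lt _ dv); rewrite /M; lra.
have tk : 0 < t k < delta.
  by rewrite t_gt0 /=; near: k; exact: (cvgr_lt _ t0).
have := bound _ tk; have := e k; rewrite u0 mulr0 addr0 => ek.
have : t k ^+ 2 / 2 * (M + d k) < 0.
  by rewrite pmulr_rlt0 ?divr_gt0 ?exprn_gt0 //; lra.
lra.
Unshelve. all: by end_near. Qed.

End SecondOrderExpansion.

(** * Theorems of the alternative for affine inequalities *)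

Section Farkas.
Context {R : realType}.

(** The one-variable case of Fourier-Motzkin elimination: a value between finitely many lower and
    upper bounds. *)
Lemma separating_point (lo hi : seq R) :
  (forall x y, x \in lo -> y \in hi -> x <= y) ->
  exists t, (forall x, x \in lo -> x <= t) /\ (forall y, y \in hi -> t <= y).
Proof.
elim: lo => [|x lo IH] le_lohi.
  elim: hi {le_lohi} => [|y hi [t [_ t_le]]]; first by exists 0.
  exists (Num.min y t); split=> // z; rewrite in_cons => /predU1P[->|/t_le].
    by rewrite ge_min lexx.
  by move=> tz; rewrite ge_min tz orbT.
have [z y zlo yhi|t [lo_le t_le]] := IH.
  by apply: le_lohi => //; rewrite in_cons zlo orbT.
exists (Num.max x t); split=> [z|y yhi].
  rewrite in_cons => /predU1P[->|/lo_le]; rewrite le_max ?lexx //.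
  by move=> ->; rewrite orbT.
by rewrite ge_max t_le // le_lohi // mem_head.
Qed.

Context {n : nat}.
Implicit Types (q : 'rV[R]_n * R) (v : 'rV[R]_n) (k : nat).

Definition affine_val q v : R := dot q.1 v + q.2.

Definition convex_cone (K : set ('rV[R]_n * R)) : Prop :=
  forall (c d : R) x y, 0 <= c -> 0 <= d -> K x -> K y -> K (c *: x + d *: y).

(* Fourier-Motzkin elimination: the coordinates of index at least [k] have
   already been eliminated. *)
Lemma farkas_elimination k (S : seq ('rV[R]_n * R)) K :
  convex_cone K -> (forall q, q \in S -> K q) ->
  (forall q (i : 'I_n), q \in S -> (k <= i)%N -> q.1 0 i = 0) ->
  (exists v, forall q, q \in S -> affine_val q v <= 0) \/
  exists2 a : R, 0 < a & K (0, a).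
Proof.
move=> cK; elim: k S => [|k IH] S SK S0.
  (* All linear parts vanish, so the inequalities are between constants: a positive one is a
     certificate, otherwise [0] is a solution. *)
  have [[q qS q_gt0]|no] := pselect (exists2 q, q \in S & 0 < q.2).
    right; exists q.2 => //; have -> : (0, q.2) = q; last exact: SK.
    case: q qS q_gt0 => a b qS _ /=; congr (_, _).
    by apply/rowP => i; rewrite mxE (S0 _ i qS).
  left; exists 0 => q qS; rewrite /affine_val dot0r add0r leNgt.
  by apply/negP => q_gt0; apply: no; exists q.
have [nk|kn] := leqP n k.
  by apply: IH => // q i _ ki; have := leq_trans nk ki; rewrite leqNgt ltn_ord.
pose j := Ordinal kn.
pose P := [seq q : 'rV[R]_n * R <- S | 0 < q.1 0 j].
pose N := [seq q : 'rV[R]_n * R <- S | q.1 0 j < 0].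
(* For [q] in [P] and [r] in [N] both coefficients are positive and coordinate [j] cancels. *)
pose comb (q r : 'rV[R]_n * R) : 'rV[R]_n * R := q.1 0 j *: r + (- r.1 0 j) *: q.
pose S' := [seq q : 'rV[R]_n * R <- S | q.1 0 j == 0] ++
  [seq comb q r | q <- P, r <- N].
have [q|q i|[v v_sol]|?] := IH S'; last by right.
- rewrite mem_cat => /orP[|/allpairsP[[r s]] /= [+ + ->]].
    by rewrite mem_filter => /andP[_ /SK].
  rewrite !mem_filter => /andP[r_gt0 rS] /andP[s_lt0 sS].
  by apply: cK; rewrite ?oppr_ge0 ?ltW //; apply: SK.
- rewrite mem_cat => /orP[|/allpairsP[[r s]] /= [+ + ->]]; rewrite !mem_filter.
    move=> /andP[/eqP q0 qS]; rewrite leq_eqVlt => /predU1P[ki|]; last exact: S0.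
    by rewrite -q0; congr (q.1 _ _); apply: val_inj.
  move=> /andP[_ rS] /andP[_ sS]; rewrite !mxE leq_eqVlt => /predU1P[ki|ki].
    by have -> : i = j; [apply: val_inj | ring].
  by rewrite (S0 r i) // (S0 s i) // !mulr0 addr0.
(* The step along coordinate [j] at which [q] vanishes: a lower limit for [N], an upper limit for
   [P]. The inequalities [comb] make these limits compatible. *)
left; pose bound (q : 'rV[R]_n * R) := - affine_val q v / q.1 0 j.
have [x y /mapP[s sN ->] /mapP[r rP ->]|t [lo_t t_hi]] :=
    @separating_point (map bound N) (map bound P).
  have /v_sol : comb r s \in S'.
    by rewrite mem_cat; apply/orP; right; apply: allpairs_f.
  move: rP sN; rewrite !mem_filter /bound /affine_val => /andP[r0 _] /andP[s0 _].
  rewrite dotDl !dotZl /= => le0.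
  rewrite ler_ndivrMr // mulrAC ler_pdivrMr //.
  by move: le0; rewrite /GRing.scale /=; lra.
exists (v + t *: delta_mx 0 j) => q qS.
rewrite /affine_val dotDr dotZr dot_delta addrAC -/(affine_val q v).
case: (ltgtP (q.1 0 j) 0) => [q_lt0|q_gt0|q_eq0].
- have := lo_t (bound q); rewrite map_f ?mem_filter ?q_lt0 // => /(_ isT).
  by rewrite ler_ndivrMr //; lra.
- have := t_hi (bound q); rewrite map_f ?mem_filter ?q_gt0 // => /(_ isT).
  by rewrite ler_pdivlMr //; lra.
- rewrite q_eq0 mulr0 addr0; apply: v_sol.
  by rewrite mem_cat mem_filter q_eq0 eqxx qS.
Qed.

(** Membership in an arbitrary convex cone containing [S] replaces bookkeeping of multipliers during
    elimination; they reappear when [K] is chosen as a set of explicit combinations. *)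
Lemma farkas (S : seq ('rV[R]_n * R)) K :
  convex_cone K -> (forall q, q \in S -> K q) ->
  (exists v, forall q, q \in S -> affine_val q v <= 0) \/
  exists2 a : R, 0 < a & K (0, a).
Proof.
move=> cK SK; apply: (@farkas_elimination n) => // q i _.
by rewrite leqNgt ltn_ord.
Qed.

End Farkas.

(** In the last alternative, if all [lambda] vanish, then [mu] certifies that the nonstrict
    inequalities are inconsistent by themselves. *)
Lemma motzkin_affine {R : realType} {n : nat} (I J : finType)
    (P : pred I) (Q : pred J) (a : I -> 'rV[R]_n) (alpha : I -> R)
    (b : J -> 'rV[R]_n) (beta : J -> R) :
  ~ (exists v, (forall i, P i -> dot (a i) v + alpha i < 0) /\
               (forall j, Q j -> dot (b j) v + beta j <= 0)) ->
  exists lambda mu, ((forall i, 0 <= lambda i) /\ (forall j, 0 <= mu j)) /\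
    ((forall i, ~~ P i -> lambda i = 0) /\ (forall j, ~~ Q j -> mu j = 0)) /\
    \sum_i lambda i *: a i + \sum_j mu j *: b j = 0 /\
    0 <= \sum_i lambda i * alpha i + \sum_j mu j * beta j /\
    ((exists i, lambda i != 0) \/ 0 < \sum_j mu j * beta j).
Proof.
move=> infeasible.
(* With a slack variable [tau] for homogenization, the system reads
   a v + alpha tau <= - 1, b v + beta tau <= 0, 1 <= tau. *)
pose A i : 'rV[R]_(n + 1) * R := (row_mx (a i) (alpha i)%:M, 1).
pose B j : 'rV[R]_(n + 1) * R := (row_mx (b j) (beta j)%:M, 0).
pose C : 'rV[R]_(n + 1) * R := (row_mx 0 (-1)%:M, 1).
pose K : set ('rV[R]_(n + 1) * R) := [set q | exists lambda mu nu,
  [/\ (forall i, 0 <= lambda i) /\ (forall i, ~~ P i -> lambda i = 0),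
      (forall j, 0 <= mu j) /\ (forall j, ~~ Q j -> mu j = 0), 0 <= nu &
      q = \sum_i lambda i *: A i + \sum_j mu j *: B j + nu *: C]].
have K_cone : convex_cone K.
  move=> c d x y c0 d0 [l1 [m1 [k1 [[l10 l1P] [m10 m1Q] k10 ->{x}]]]].
  move=> [l2 [m2 [k2 [[l20 l2P] [m20 m2Q] k20 ->{y}]]]].
  exists (fun i => c * l1 i + d * l2 i), (fun j => c * m1 j + d * m2 j),
    (c * k1 + d * k2); split.
  - by split=> i; [rewrite addr_ge0 ?mulr_ge0 | move=> /[dup] /l1P -> /l2P ->];
      rewrite ?mulr0 ?addr0.
  - by split=> i; [rewrite addr_ge0 ?mulr_ge0 | move=> /[dup] /m1Q -> /m2Q ->];
      rewrite ?mulr0 ?addr0.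
  - by rewrite addr_ge0 ?mulr_ge0.
  rewrite !scalerDr !scaler_sumr scalerDl -!scalerA.
  under [X in _ = X + _ + _]eq_bigr do rewrite scalerDl -!scalerA.
  under [X in _ = _ + X + _]eq_bigr do rewrite scalerDl -!scalerA.
  by rewrite !big_split /= addrACA [X in X + _]addrACA.
have KA i : P i -> K (A i).
  move=> Pi; exists (fun k => (k == i)%:R), (fun=> 0), 0; split=> //.
  - by split=> k; [rewrite ler0n | case: eqP => // ->; rewrite Pi].
  - rewrite scale0r addr0 [X in _ + X]big1 ?addr0 => [|k _]; rewrite ?scale0r //.
    rewrite (bigD1 i) //= eqxx scale1r big1 ?addr0 // => k /negbTE ->.
    by rewrite scale0r.
have KB j : Q j -> K (B j).
  move=> Qj; exists (fun=> 0), (fun k => (k == j)%:R), 0; split=> //.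
  - by split=> k; [rewrite ler0n | case: eqP => // ->; rewrite Qj].
  - rewrite scale0r addr0 [X in X + _]big1 ?add0r => [|k _]; rewrite ?scale0r //.
    rewrite (bigD1 j) //= eqxx scale1r big1 ?addr0 // => k /negbTE ->.
    by rewrite scale0r.
have KC : K C.
  exists (fun=> 0), (fun=> 0), 1; split=> //.
  by rewrite !big1 ?addr0 ?add0r ?scale1r // => k _; rewrite scale0r.
pose S := C :: [seq A i | i <- enum P] ++ [seq B j | j <- enum Q].
have [q|[v v_sol]|[s s_gt0 [l [mu [nu [[l0 lP] [mu0 muQ] nu0 eqK]]]]]] :=
    @farkas R _ S K K_cone.
- rewrite in_cons mem_cat => /or3P[/eqP -> //|/mapP[i +] ->|/mapP[j +] ->].
    by rewrite mem_enum => /KA.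
  by rewrite mem_enum => /KB.
- case: infeasible; move: v_sol.
  rewrite -[v]hsubmxK; set x := lsubmx v; set y := rsubmx v => v_sol.
  have dot1 c : dot c%:M y = c * y 0 0.
    by rewrite /dot big_ord1 mxE eqxx.
  have y_gt0 : 0 < y 0 0.
    have := v_sol C (mem_head _ _).
    by rewrite /affine_val dot_row_mx dot0l dot1 /=; lra.
  (* Division by the slack value undoes the homogenization. *)
  exists ((y 0 0)^-1 *: x); split=> k kP.
    rewrite dotZr -(pmulr_rlt0 _ y_gt0).
    have /v_sol : A k \in S.
      by rewrite in_cons mem_cat map_f ?orbT // mem_enum.
    rewrite /affine_val dot_row_mx dot1 /= mulrDr mulrA mulfV ?gt_eqF // mul1r.
    lra.
  rewrite dotZr -(pmulr_rle0 _ y_gt0).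
  have /v_sol : B k \in S.
    by rewrite in_cons mem_cat (map_f B) ?orbT // mem_enum.
  rewrite /affine_val dot_row_mx dot1 /= mulrDr mulrA mulfV ?gt_eqF // mul1r.
  lra.
- exists l, mu; split=> //; split=> //.
  (* The constant component reads [s = sum l + nu] with [s > 0], and the slack coordinate identifies
     [nu] with the second-order sum; if [l] vanishes, that sum is [s]. *)
  have eq2 : s = \sum_i l i + nu.
    have := congr1 snd eqK; rewrite /= !raddf_sum /= [X in _ + X + _]big1.
      rewrite /GRing.scale /= mulr1 addr0 => ->; congr (_ + _).
      by apply: eq_bigr => i _; rewrite mulr1.
    by move=> i _; rewrite /GRing.scale /= mulr0.
  have eq1 := congr1 fst eqK; rewrite /= !raddf_sum /= in eq1.
  have eqab : \sum_i l i *: a i + \sum_j mu j *: b j = 0.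
    apply/rowP => k.
    move: (congr1 (fun M : 'rV[R]_(n + 1) => M 0 (lshift 1 k)) eq1).
    rewrite mxE [in RHS]mxE [in X in _ = X + _]mxE [in X in _ = _ + X]mxE.
    rewrite row_mxEl [in X in _ = _ + X]mxE mulr0 addr0 => eqk.
    rewrite mxE [RHS]mxE {}eqk !summxE.
    by congr (_ + _); apply: eq_bigr => i _; rewrite mxE [RHS]mxE row_mxEl.
  have eqt : \sum_i l i * alpha i + \sum_j mu j * beta j = nu.
    move: (congr1 (fun M : 'rV[R]_(n + 1) => M 0 (rshift n 0)) eq1).
    rewrite mxE [in RHS]mxE [in X in _ = X + _]mxE [in X in _ = _ + X]mxE.
    rewrite row_mxEr [in X in _ = _ + X]mxE eqxx mulrN1 => /esym/eqP.
    rewrite subr_eq0 !summxE => /eqP <-.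
    by congr (_ + _); apply: eq_bigr => i _; rewrite mxE row_mxEr mxE eqxx.
  split=> //; rewrite eqt; split=> //.
  have [lambda0|/existsNP[i /eqP li]] := pselect (forall i, l i = 0); last first.
    by left; exists i.
  right; rewrite big1 ?add0r in eqt => [|i _]; last by rewrite lambda0 mul0r.
  by rewrite eqt; move: s_gt0; rewrite eq2 big1 ?add0r.
Qed.

(** * Primal optimality and construction of the multipliers *)

Section Optimality.
Context {R : realType} {n m p : nat}.
Context {f : 'rV[R]_n -> 'rV[R]_m} {g : 'rV[R]_n -> 'rV[R]_p} {xbar : 'rV[R]_n}.
Context (f_C11 : forall l, C11 (component f l)).
Context (xbar_eff : local_weak_efficient f (feasible g) xbar).

(** Second-order inequalities are imposed on critical indices only: for the other objectives and
    active constraints the first-order term along [u] is negative, which settles descent and the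
    lexicographic condition. *)
Lemma no_parabolic_descent (u : 'rV[R]_n) (xi : 'I_m -> 'rV[R]_n)
    (zeta : 'I_p -> 'rV[R]_n) :
  (forall l, is_maximizer (subdiff2 (component f l) xbar u) u (xi l)) ->
  L2 g xbar u zeta `<=` T2 (feasible g) xbar u ->
  critical f g xbar u ->
  ~ exists v,
    (forall l, `[< critical_objectives f xbar u l >] ->
       dot (gradient (component f l) xbar) v + dot (xi l) u < 0) /\
    (forall i, `[< critical_constraints g xbar u i >] ->
       dot (gradient (component g i) xbar) v + dot (zeta i) u <= 0).
Proof.
move=> xi_max abadie [fu _ gu] [v [fv gv]].
have [i i_active|t [vk [t_gt0 t0 vkv feas]]] := abadie v.
  have := gu i i_active; rewrite le_eqVlt => /predU1P[gu0|]; last by left.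
  by right; split=> //; apply: gv; apply/asboolP.
have [_ [U Ux]] := xbar_eff; apply.
pose x k := xbar + t k *: u + (t k ^+ 2 / 2) *: vk k.
have xU : \forall k \near \oo, U (x k).
  suff : x @ \oo --> xbar by apply.
  rewrite -[X in _ --> X]addr0 -(scale0r v) -[X in X + _]addr0 -(scale0r u).
  apply: cvgD; first by apply: cvgD; [exact: cvg_cst | exact: cvgZr_tmp].
  apply: cvgZ => //; have -> : (0 : R) = 0 * 0 / 2 by rewrite !mul0r.
  by apply: cvgMr_tmp; exact: cvgM.
have descent : \forall k \near \oo, forall l,
    component f l (x k) < component f l xbar.
  apply: filter_forall => l.
  apply: (parabolic_descent (f_C11 l)) (xi_max l) _ t_gt0 t0 vkv.
  have := fu l; rewrite le_eqVlt => /predU1P[fu0|]; last by left.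
  by right; split=> //; apply: fv; apply/asboolP.
have [k [Uk dk]] := filter_ex (filterI xU descent).
by exists (x k); [split=> //; exact: feas | exact: dk].
Qed.

End Optimality.

Theorem theorem3p7 (R : realType) (n m p : nat)
    (f : 'rV[R]_n -> 'rV[R]_m) (g : 'rV[R]_n -> 'rV[R]_p)
    (f_C11 : forall l, C11 (component f l))
    (g_C11 : forall i, C11 (component g i))
    (xbar : 'rV[R]_n)
    (xbar_eff : local_weak_efficient f (feasible g) xbar)
    (xi : 'rV[R]_n -> 'I_m -> 'rV[R]_n)
    (xi_max : forall u l,
       is_maximizer (subdiff2 (component f l) xbar u) u (xi u l))
    (zeta : 'rV[R]_n -> 'I_p -> 'rV[R]_n)
    (zeta_max : forall u i,
       is_maximizer (subdiff2 (component g i) xbar u) u (zeta u i))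
    (abadie2 : forall u, critical f g xbar u ->
       L2 g xbar u (zeta u) `<=` T2 (feasible g) xbar u)
    (ubar : 'rV[R]_n) (ubar_crit : critical f g xbar ubar) :
  exists (lambda : 'rV[R]_m) (mu : 'rV[R]_p),
    ((forall l, 0 <= lambda 0 l) /\ lambda <> 0) /\
    (forall i, 0 <= mu 0 i) /\
    \sum_(l < m) lambda 0 l *: gradient (component f l) xbar
      + \sum_(i < p) mu 0 i *: gradient (component g i) xbar = 0 /\
    0 <= \sum_(l < m) lambda 0 l * dot (xi ubar l) ubar
         + \sum_(i < p) mu 0 i * dot (zeta ubar i) ubar /\
    (forall l, ~ critical_objectives f xbar ubar l -> lambda 0 l = 0) /\
    (forall i, ~ critical_constraints g xbar ubar i -> mu 0 i = 0) /\
    (forall w, (critical_cone g xbar ubar `&` orthogonal_space ubar) w ->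
       0 <= \sum_(l < m) lambda 0 l * dot (gradient (component f l) xbar) w).
Proof.
pose a l := gradient (component f l) xbar.
pose b i := gradient (component g i) xbar.
pose alpha l := dot (xi ubar l) ubar; pose beta i := dot (zeta ubar i) ubar.
(* Only support in the active set is recorded, since multipliers for [0] and [ubar] get combined;
   support in the sets critical at [ubar] is recovered from stationarity tested on [ubar]. *)
have multipliers u : critical f g xbar u -> exists lambda mu,
    ((forall l, 0 <= lambda l) /\ (forall i, 0 <= mu i)) /\
    (forall i, ~ active g xbar i -> mu i = 0) /\
    \sum_l lambda l *: a l + \sum_i mu i *: b i = 0 /\
    0 <= \sum_l lambda l * dot (xi u l) u + \sum_i mu i * dot (zeta u i) u /\
    ((exists l, lambda l != 0) \/ 0 < \sum_i mu i * dot (zeta u i) u).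
  move=> crit.
  have [l [mu [ge0 [[_ muQ] ?]]]] := motzkin_affine _ _ _ _ _ _ _ _
    (no_parabolic_descent f_C11 xbar_eff _ _ _ (xi_max u) (abadie2 u crit) crit).
  exists l, mu; split=> //; split=> // i inactive.
  by apply: muQ; apply/asboolP => -[].
have [fu [l0 _] gu] := ubar_crit.
have [lambda [mu [l_ge0 [mu_ge0 [mu_active [stat [second [k lk]]]]]]]] :
    exists (lambda : 'I_m -> R) (mu : 'I_p -> R),
    (forall l, 0 <= lambda l) /\ (forall i, 0 <= mu i) /\
    (forall i, ~ active g xbar i -> mu i = 0) /\
    \sum_l lambda l *: a l + \sum_i mu i *: b i = 0 /\
    0 <= \sum_l lambda l * alpha l + \sum_i mu i * beta i /\
    (exists l, lambda l != 0).
  have [l [mu [[l_ge0 mu_ge0] [mu_act [stat [second l_neq0]]]]]] :=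
    multipliers ubar ubar_crit.
  have [l_ex|l_eq0] := pselect (exists i, l i != 0).
    by exists l, mu.
  have {l_neq0} sigma_gt0 : 0 < \sum_i mu i * beta i by case: l_neq0.
  have {}l_eq0 i : l i = 0.
    by apply/eqP/negP => /negP li; apply: l_eq0; exists i.
  have crit0 : critical f g xbar 0.
    by split=> [k||k _]; [| exists l0 |]; rewrite dot0r.
  have [l' [mu' [[l'_ge0 mu'_ge0] [mu'_act [stat' [_ l'_neq0]]]]]] :=
    multipliers 0 crit0.
  (* In direction [0] the other alternative would read [0 < 0]. *)
  have {}l'_neq0 : exists i, l' i != 0.
    case: l'_neq0 => //; rewrite big1 ?ltxx // => i _.
    by rewrite dot0r mulr0.
  (* [S] evaluates the multipliers of direction [0] on the second-order data of [ubar]; adding [c]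
     times [mu] raises it by exactly [|S|]. *)
  pose S := \sum_i l' i * alpha i + \sum_i mu' i * beta i.
  pose c := `|S| / \sum_i mu i * beta i.
  have c_ge0 : 0 <= c by rewrite divr_ge0 // ltW.
  exists l', (fun i => mu' i + c * mu i); split=> //.
  split; [|split; [|split; [|split=> //]]].
  - by move=> i; rewrite addr_ge0 // mulr_ge0.
  - by move=> i ni; rewrite mu'_act // mu_act // mulr0 addr0.
  - under [X in _ + X]eq_bigr do rewrite scalerDl -scalerA.
    rewrite big_split addrA stat' add0r /= -scaler_sumr.
    rewrite big1 ?add0r in stat => [|i _]; last by rewrite l_eq0 scale0r.
    by rewrite stat scaler0.
  - under [X in _ + X]eq_bigr do rewrite mulrDl -mulrA.
    rewrite big_split addrA /= -mulr_sumr /c divfK ?gt_eqF // -/S.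
    by have := ler_norm (- S); rewrite normrN; lra.
have dot_stat w : \sum_l lambda l * dot (a l) w + \sum_i mu i * dot (b i) w = 0.
  rewrite -[RHS](dot0l w) -stat dotDl !dot_suml.
  under [X in _ = X + _]eq_bigr do rewrite dotZl.
  by under [X in _ = _ + X]eq_bigr do rewrite dotZl.
(* Every term of [dot_stat ubar] is nonpositive, hence zero. *)
have lu l : lambda l * dot (a l) ubar <= 0.
  exact: mulr_ge0_le0 (l_ge0 l) (fu l).
have muu i : mu i * dot (b i) ubar <= 0.
  have [/gu gi|/mu_active ->] := pselect (active g xbar i).
    exact: mulr_ge0_le0 (mu_ge0 i) gi.
  by rewrite mul0r.
have sum_eq0 (I : finType) (F : I -> R) : (forall i, F i <= 0) ->
    0 <= \sum_i F i -> forall i, F i = 0.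
  move=> F_le0 sum_ge0 i; apply/eqP; rewrite eq_le F_le0 /= (le_trans sum_ge0) //.
  by rewrite (bigD1 i) //= gerDl sumr_le0.
have l_sum : \sum_l lambda l * dot (a l) ubar <= 0 by apply: sumr_le0.
have mu_sum : \sum_i mu i * dot (b i) ubar <= 0 by apply: sumr_le0.
have stat_u := dot_stat ubar.
have lu0 : forall l, lambda l * dot (a l) ubar = 0.
  by apply: sum_eq0 => //; lra.
have muu0 : forall i, mu i * dot (b i) ubar = 0.
  by apply: sum_eq0 => //; lra.
have mu_supp i : ~ critical_constraints g xbar ubar i -> mu i = 0.
  move=> nci; have [act|] := pselect (active g xbar i); last exact: mu_active.
  have /eqP := muu0 i; rewrite mulf_eq0 => /predU1P[//|/eqP bu0].
  by case: nci.
exists (\row_l lambda l), (\row_i mu i).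
split; [split|split; [|split; [|split; [|split; [|split]]]]].
- by move=> l; rewrite mxE.
- by move=> /rowP/(_ k); rewrite !mxE => /eqP; rewrite (negbTE lk).
- by move=> i; rewrite mxE.
- under eq_bigr do rewrite mxE.
  by under [X in _ + X]eq_bigr do rewrite mxE.
- under eq_bigr do rewrite mxE.
  by under [X in _ + X]eq_bigr do rewrite mxE.
- move=> l ncl; rewrite mxE; have /eqP := lu0 l.
  by rewrite mulf_eq0 => /predU1P[//|/eqP/ncl].
- by move=> i nci; rewrite mxE mu_supp.
- move=> w [w_cone _]; under eq_bigr do rewrite mxE.
  (* By [dot_stat], the objective sum is the opposite of this one, and [mu] lives on the constraints
     defining the critical cone. *)
  have mu_w : \sum_i mu i * dot (b i) w <= 0.
    apply: sumr_le0 => i _.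
    have [ci|/mu_supp ->] := pselect (critical_constraints g xbar ubar i).
      exact: mulr_ge0_le0 (mu_ge0 i) (w_cone i ci).
    by rewrite mul0r.
  by have := dot_stat w; lra.
Qed.
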